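(* Let $\kappa$ be an uncountable cardinal. Consider the statements: (1) ${\sf BC}_\kappa$; (2) ${\sf BC}({}^\kappa2,\kappa)$; (3) every Rothberger bounded subgroup of the group $({}^\kappa2,\oplus)$ has cardinality at most $\kappa$; (4) $\neg{\sf KH}(\kappa,\aleph_1)$. Then each of these statements implies all the succeeding ones; moreover, if Borel's Conjecture ${\sf BC}$ holds, then all four are equivalent.
   Context: All topological groups are assumed Tychonoff. $({}^\kappa2,\oplus)$ is the group of functions $\kappa\to\{0,1\}$ with coordinatewise addition mod 2 and the product topology. A topological group $(G,* )$ is $\aleph_0$-bounded if for every open neighborhood $U$ of the identity countably many translates of $U$ cover $G$. A subset $X$ of $G$ is Rothberger bounded if for every sequence $(U_n:n<\omega)$ of open neighborhoods of the identity there are $g_n\in G$ with $X\subseteq\bigcup_n g_n*U_n$. ${\sf BC}_\kappa$: every Rothberger bounded subset of an $\aleph_0$-bounded topological group of weight $\kappa$ has cardinality at most $\kappa$. ${\sf BC}({}^\kappa2,\kappa)$: every Rothberger bounded subset of ${}^\kappa2$ has cardinality at most $\kappa$. ${\sf BC}$ (Borel's Conjecture, equivalently ${\sf BC}_{\aleph_0}$): every strong measure zero set of reals is countable. A $(\kappa,\aleph_1)$ Kurepa family is a family $\mathcal F$ of subsets of $\kappa$ with $|\mathcal F|>\kappa$ such that $\{X\cap A:X\in\mathcal F\}$ is countable for every countable infinite $A\subseteq\kappa$; ${\sf KH}(\kappa,\aleph_1)$ asserts such a family exists. *)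

(* Defs.v *)
From HB Require Import structures.
From mathcomp Require Import all_boot all_order all_algebra.
From mathcomp Require Import all_classical all_reals all_analysis.
From mathcomp Require Import Rstruct Rstruct_topology.
From Stdlib Require Import Rdefinitions.
Set Implicit Arguments. Unset Strict Implicit. Unset Printing Implicit Defensive.
Import Order.TTheory GRing.Theory Num.Theory.
Local Open Scope classical_set_scope.
Local Open Scope ring_scope.
Local Open Scope card_scope.

Definition tychonoff (T : topologicalType) : Prop :=
  completely_regular_space T /\ accessible_space T.

Definition topological_group (G : topologicalType)
  (mul : G -> G -> G) (inv : G -> G) (e : G) : Prop :=
  [/\ associative mul, left_id e mul & left_inverse e inv mul] /\
  [/\ continuous (fun p : G * G => mul p.1 p.2),
      continuous inv & tychonoff G].

Definition aleph0_bounded (G : topologicalType) (mul : G -> G -> G) (e : G) : Prop :=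
  forall U : set G, open_nbhs e U ->
    exists g : nat -> G, [set: G] `<=` \bigcup_n (mul (g n) @` U).

Definition rothberger_bounded (G : topologicalType) (mul : G -> G -> G) (e : G)
  (X : set G) : Prop :=
  forall U : nat -> set G, (forall n, open_nbhs e (U n)) ->
    exists g : nat -> G, X `<=` \bigcup_n (mul (g n) @` U n).

Definition has_weight (G : topologicalType) (K : Type) : Prop :=
  (exists2 B : set (set G), basis B & B #<= [set: K]) /\
  (forall B : set (set G), basis B -> [set: K] #<= B).

Definition BC_kappa (K : Type) : Prop :=
  forall (G : topologicalType) (mul : G -> G -> G) (inv : G -> G) (e : G),
    topological_group mul inv e -> aleph0_bounded mul e -> has_weight G K ->
    forall X : set G, rothberger_bounded mul e X -> X #<= [set: K].

Definition Cantor (K : Type) : topologicalType := {ptws K -> bool}.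
Definition cantor_add (K : Type) (f g : Cantor K) : Cantor K :=
  fun k => addb (f k) (g k).
Definition cantor_zero (K : Type) : Cantor K := fun _ => false.
Arguments cantor_zero K : clear implicits.

Definition BC_cantor (K : Type) : Prop :=
  forall X : set (Cantor K),
    rothberger_bounded (@cantor_add K) (cantor_zero K) X -> X #<= [set: K].

Definition cantor_subgroup (K : Type) (H : set (Cantor K)) : Prop :=
  H (cantor_zero K) /\ forall x y, H x -> H y -> H (cantor_add x y).

Definition BC_cantor_subgroup (K : Type) : Prop :=
  forall H : set (Cantor K), cantor_subgroup H ->
    rothberger_bounded (@cantor_add K) (cantor_zero K) H -> H #<= [set: K].

Definition KH (K : Type) : Prop :=
  exists F : set (set K), ~ (F #<= [set: K]) /\
    forall A : set K, countable A -> infinite_set A ->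
      countable [set X `&` A | X in F].

Definition strong_measure_zero (X : set R) : Prop :=
  forall eps : nat -> R, (forall n, 0 < eps n) ->
    exists a : nat -> R, X `<=` \bigcup_n [set` `[a n, a n + eps n]].

Definition BorelConjecture : Prop :=
  forall X : set R, strong_measure_zero X -> countable X.

(* Main.v *)
(** The only deep implication is that Borel's Conjecture and the failure of
    [KH] give [BC_kappa].  Let [X] be a Rothberger bounded subset of a group
    [G] of weight [K].  For each neighborhood [B] of the identity in a basis of
    size [K], a chain [U_n] of symmetric open neighborhoods with
    [U_(n+1) U_(n+1) <= U_n <= B] defines a uniformity with a countable base,
    and Borel's Conjecture implies that only countably many points of [X] are
    distinguished by it; let [c_B : X -> nat] number them.  The graphs of the
    functions [B |-> c_B x], for [x] in [X], are subsets of a set of size [K];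
    they are pairwise distinct because [G] is T1, and their traces on a
    countable set are again controlled by a single chain, so they form a Kurepa
    family as soon as [X] has more than [K] elements.

    To pass from the reals to such uniformities, number a countable cover of
    [X] by translates of [U_n] for each [n], and let [h x n] be the index of the
    first translate that is a neighborhood of [x].  Each [x] has a modulus
    [mu x] witnessing this.  On the points whose modulus is bounded by a fixed
    function, [h] is uniformly continuous, so its image is a strong measure zero
    set, hence countable.  Therefore, on a transversal of [h], the moduli form a
    subset of [nat -> nat] all of whose bounded subsets are countable.  Such
    a set is concentrated on a countable set, hence strong measure zero, hence
    countable, and then [h] has a countable image.

    Conversely, a Kurepa family generates a subgroup of the Cantor cube with
    countable restrictions to countable sets, and such a subgroup is Rothberger
    bounded because a sequence of basic open sets only involves countably many
    coordinates. *)
From HB Require Import structures.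
Require Import Defs.
From mathcomp Require Import all_boot all_order all_algebra.
From mathcomp Require Import all_classical all_reals all_analysis.
From mathcomp Require Import Rstruct lra.
Local Open Scope classical_set_scope.
Local Open Scope card_scope.

Set Implicit Arguments.
Unset Strict Implicit.
Unset Printing Implicit Defensive.

(** * Cardinality *)

Lemma card_le_of_inj {T U : Type} (A : set T) (B : set U) (f : T -> U) :
  (forall x, A x -> B (f x)) ->
  (forall x y, A x -> A y -> f x = f y -> x = y) -> A #<= B.
Proof.
move=> fAB finj; suff : $|{injfun A >-> B}| by case=> g; exact: inj_card_le.
by apply/injfunPex; exists f => // x y /set_mem + /set_mem; exact: finj.
Qed.

Lemma card_le_fun_inj {T U : Type} (A : set T) (B : set U) (u0 : U) : A #<= B ->
  exists f : T -> U, (forall x, A x -> B (f x)) /\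
    (forall x y, A x -> A y -> f x = f y -> x = y).
Proof.
elim/Pchoice: U => U in B u0 *.
move=> AB; pose U' : pointedType := HB.pack U (isPointed.Build U u0).
have /injfunPex[f fAB finj] := @pcard_leP T U' A B AB.
by exists f; split=> // x y Ax Ay; apply: finj; exact/mem_set.
Qed.

(** A maximal graph of a partial injection from [A] to [B] exhausts [A] or [B]; otherwise one more
    pair could be added. *)
Lemma card_le_total {T U : Type} (A : set T) (B : set U) :
  A #<= B \/ B #<= A.
Proof.
have [->|/set0P[a0 Aa0]] := eqVneq A set0; first by left; exact: card_ge0.
have [->|/set0P[b0 Bb0]] := eqVneq B set0; first by right; exact: card_ge0.
pose P (G : set (T * U)) := [/\ forall p, G p -> A p.1 /\ B p.2,
  forall x y y', G (x, y) -> G (x, y') -> y = y' &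
  forall x x' y, G (x, y) -> G (x', y) -> x = x'].
have [F FP Ftot|G [[GAB Gf Gi] Gmax]] := @Zorn_bigcup _ P.
  have two p q : (\bigcup_(X in F) X) p -> (\bigcup_(X in F) X) q ->
      exists2 X, F X & X p /\ X q.
    move=> [X FX Xp] [Y FY Yq].
    by have [XY|YX] := Ftot _ _ FX FY; [exists Y|exists X] => //; split=> //;
      [exact: XY|exact: YX].
  split=> [p [X /FP[+ _ _] Xp]|x y y' p q|x x' y p q]; first exact.
  - by have [X /FP[_ + _] [Xp Xq]] := two _ _ p q; apply; [exact: Xp|].
  - by have [X /FP[_ _ +] [Xp Xq]] := two _ _ p q; apply; [exact: Xp|].
have [domA|/existsNP[a /not_implyP[Aa aN]]] :=
    pselect (forall x, A x -> exists y, G (x, y)).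
  left; have /choice[f fP] : forall x, exists y, A x -> G (x, y).
    move=> x; have [/domA[y Gxy]|nAx] := pselect (A x); first by exists y.
    by exists b0.
  apply: (@card_le_of_inj _ _ A B f) => [x Ax|x y Ax Ay fxy].
    by have [] := GAB _ (fP _ Ax).
  by apply: (Gi _ _ (f x)); [exact: fP|rewrite fxy; exact: fP].
have [ranB|/existsNP[b /not_implyP[Bb bN]]] :=
    pselect (forall y, B y -> exists x, G (x, y)).
  right; have /choice[f fP] : forall y, exists x, B y -> G (x, y).
    move=> y; have [/ranB[x Gxy]|nBy] := pselect (B y); first by exists x.
    by exists a0.
  apply: (@card_le_of_inj _ _ B A f) => [x Bx|x y Bx By fxy].
    by have [] := GAB _ (fP _ Bx).
  by apply: (Gf (f x)); [exact: fP|rewrite fxy; exact: fP].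
exfalso; apply: (Gmax (G `|` [set (a, b)])).
  split; first exact: subsetUl.
  by move=> /(_ (a, b) (or_intror erefl)) Gab; apply: aN; exists b.
split=> [p [/GAB//|->//]|x y y'|x x' y].
  move=> [Gxy|/pair_equal_spec[-> ->]] [Gxy'|/pair_equal_spec[xa ->]];
    first exact: Gf Gxy Gxy'.
  - by case: aN; exists y; rewrite -xa.
  - by case: aN; exists y'.
  - by [].
move=> [Gxy|/pair_equal_spec[-> ->]] [Gxy'|/pair_equal_spec[-> yb]];
  first exact: Gi Gxy Gxy'.
- by case: bN; exists x; rewrite -yb.
- by case: bN; exists x'.
- by [].
Qed.

(* Zorn's lemma yields a maximal graph of an injection [A * A -> A] extending one
   on a copy [A0] of [nat]. If [A] embeds in its complement, the graph extends to
   the union of [A] and the image [C] of this embedding, by sending the new pairs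
   into [C]; otherwise [T] itself embeds in [A]. *)
Lemma infinite_square_inj {T : Type} : infinite_set [set: T] ->
  exists f : T * T -> T, injective f.
Proof.
move=> Tinf; have [t0 _] := infinite_setN0 Tinf.
have [e [_ einj]] := card_le_fun_inj t0 (iffLR (infiniteP _) Tinf).
have {}einj m n : e m = e n -> m = n by exact: einj.
pose A0 := range e.
pose pr : nat * nat -> nat := pickle.
pose G0 := [set q | exists m n, q = ((e m, e n), e (pr (m, n)))].
pose good (G : set (T * T * T)) A :=
  [/\ forall x y, A x -> A y -> exists z, G (x, y, z),
      forall x y z, G (x, y, z) -> [/\ A x, A y & A z],
      forall p z z', G (p, z) -> G (p, z') -> z = z' &
      forall p p' z, G (p, z) -> G (p', z) -> p = p'].
have good0 : good G0 A0.
  split=> [x y|x y z [m [n [-> -> ->]]]|[x y] z z'|[x y] [x' y'] z].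
  - by move=> [m _ <-] [n _ <-]; exists (e (pr (m, n))), m, n.
  - by split; [exists m|exists n|exists (pr (m, n))].
  - by move=> [m [n [-> -> ->]]] [m' [n' [/einj<- /einj<- ->]]].
  - move=> [m [n [-> -> ->]]] [m' [n' [-> -> /einj]]].
    by move=> /(pcan_inj (@pickleK (nat * nat)%type))[-> ->].
(* [G0] is joined to [H] so that the empty chain is not a special case. *)
pose P H := exists A, good (G0 `|` H) A.
have [F FP Ftot|H [[A AG] Hmax]] := @Zorn_bigcup _ P.
  have two p q : (G0 `|` \bigcup_(X in F) X) p ->
      (G0 `|` \bigcup_(X in F) X) q ->
      exists2 X, F X \/ X = set0 & (G0 `|` X) p /\ (G0 `|` X) q.
    move=> [Gp|[X FX Xp]] [Gq|[Y FY Yq]].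
    - by exists set0; [right|split; left].
    - by exists Y; [left|split; [left|right]].
    - by exists X; [left|split; [right|left]].
    have [XY|YX] := Ftot _ _ FX FY.
      by exists Y; [left|split; right=> //; exact: XY].
    by exists X; [left|split; right=> //; exact: YX].
  have {}FP X : F X \/ X = set0 -> P X.
    by move=> [/FP//|->]; exists A0; rewrite setU0.
  have sub X : F X \/ X = set0 -> G0 `|` X `<=` G0 `|` \bigcup_(X in F) X.
    by move=> [FX|->] p [Gp|Xp]; [left|right; exists X|left|].
  (* The domain is read off the diagonal of the graph. *)
  exists [set x | exists z, (G0 `|` \bigcup_(X in F) X) (x, x, z)].
  split=> [x y|x y z xyz|p z z' pz pz'|p p' z pz p'z].
  - move=> [z xxz] [z' yyz].
    have [X FX [xxz' yyz']] := two _ _ xxz yyz.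
    have [A [Adom Aran _ _]] := FP _ FX.
    have [[Ax _ _] [Ay _ _]] := (Aran _ _ _ xxz', Aran _ _ _ yyz').
    by have [w xyw] := Adom _ _ Ax Ay; exists w; exact: sub xyw.
  - have [X FX [xyz' _]] := two _ _ xyz xyz.
    have [A [Adom Aran _ _]] := FP _ FX.
    have [Ax Ay Az] := Aran _ _ _ xyz'.
    split; [have [w xyw] := Adom _ _ Ax Ax|have [w xyw] := Adom _ _ Ay Ay|
      have [w xyw] := Adom _ _ Az Az]; by exists w; exact: sub xyw.
  - have [X FX [pX p'X]] := two _ _ pz pz'.
    by have [A [_ _ + _]] := FP _ FX; apply; [exact: pX|].
  - have [X FX [pX p'X]] := two _ _ pz p'z.
    by have [A [_ _ _]] := FP _ FX; apply; [exact: pX|].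
have [Adom Aran Afun Ainj] := AG.
have A0A x : A0 x -> A x.
  move=> [n _ <-]; have [] // := Aran (e n) (e n) (e (pr (n, n))).
  by left; exists n, n.
have /choice[g gP] : forall p : T * T, exists z, A p.1 -> A p.2 -> (G0 `|` H) (p, z).
  move=> [x y] /=; have [[Ax Ay]|nA] := pselect (A x /\ A y).
    by have [z xyz] := Adom x y Ax Ay; exists z.
  by exists t0 => Ax Ay; case: nA.
have gA x y : A x -> A y -> A (g (x, y)).
  by move=> Ax Ay; have [] := Aran _ _ _ (gP (x, y) Ax Ay).
have ginj x y x' y' : A x -> A y -> A x' -> A y' ->
    g (x, y) = g (x', y') -> (x, y) = (x', y').
  move=> Ax Ay Ax' Ay' gg; apply: (Ainj _ _ (g (x, y))).
    exact: (gP (x, y)).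
  by rewrite gg; exact: (gP (x', y')).
have [Ae0 Ae1] : A (e 0) /\ A (e 1) by split; apply: A0A; [exists 0|exists 1].
(* The tags [e 0] and [e 1] keep the points of [A] apart from those that [k] brings in from
   outside. *)
pose phi (k : T -> T) x := if pselect (A x) then g (e 0, x) else g (e 1, k x).
have phiA k x : (~ A x -> A (k x)) -> A (phi k x).
  by rewrite /phi; case: pselect => [Ax _|nAx /(_ nAx) Akx] /=; apply: gA.
have phi_inj k x y : (~ A x -> A (k x)) -> (~ A y -> A (k y)) ->
    (~ A x -> ~ A y -> k x = k y -> x = y) -> phi k x = phi k y -> x = y.
  rewrite /phi; case: pselect => [Ax _|nAx /(_ nAx) Akx] /=;
      case: pselect => [Ay _|nAy /(_ nAy) Aky] /= kinj /ginj.
  - by case/(_ _ _ _ _)/pair_equal_spec.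
  - by case/(_ _ _ _ _)/pair_equal_spec => // /einj.
  - by case/(_ _ _ _ _)/pair_equal_spec => // /einj.
  - by case/(_ _ _ _ _)/pair_equal_spec => // _ kk; exact: kinj.
have [CA|AC] := card_le_total (~` A) A.
  have [k [kA kinj]] := card_le_fun_inj t0 CA.
  have phi_inj' u v : phi k u = phi k v -> u = v.
    by apply: phi_inj; [exact: kA|exact: kA|exact: kinj].
  exists (fun p => g (phi k p.1, phi k p.2)) => -[x y] [x' y'] /= gg.
  have [/phi_inj' -> /phi_inj' -> //] :=
    ginj _ _ _ _ (phiA k _ (@kA x)) (phiA k _ (@kA y))
      (phiA k _ (@kA x')) (phiA k _ (@kA y')) gg.
have [j [jC jinj]] := card_le_fun_inj t0 AC.
pose C := j @` A.
have /choice[k kP] : forall x, exists y, C x -> A y /\ j y = x.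
  move=> x; have [[y Ay <-]|nC] := pselect (C x); first by exists y.
  by exists t0.
have CnA x : C x -> ~ A x by move=> [y Ay <-]; exact: jC.
pose N := [set q | [/\ (A `|` C) q.1.1, (A `|` C) q.1.2, ~ (A q.1.1 /\ A q.1.2)
  & q.2 = j (g (phi k q.1.1, phi k q.1.2))]].
have phiAC x : (A `|` C) x -> A (phi k x).
  by move=> ACx; apply: phiA => nAx; case: ACx => // /kP[].
exfalso; apply: (Hmax (H `|` N)).
  split; first exact: subsetUl.
  move=> HN; have Cj : C (j (e 0)) by exists (e 0).
  have [] // := Aran (j (e 0)) (j (e 0)) (j (g (phi k (j (e 0)), phi k (j (e 0))))).
    right; apply: HN; right.
    by split=> //=; [right|right|case=> /(CnA _ Cj)].
  by move=> /(CnA _ Cj).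
exists (A `|` C); rewrite setUA; split=> [x y|x y z|[x y] z z'|[x y] [x' y'] z].
- move=> ACx ACy; have [[Ax Ay]|nA] := pselect (A x /\ A y).
    by have [z xyz] := Adom _ _ Ax Ay; exists z; left.
  by exists (j (g (phi k x, phi k y))); right.
- move=> [/Aran[Ax Ay Az]|[/= ACx ACy _ ->]]; first by split; left.
  by split=> //; right; exists (g (phi k x, phi k y)) => //; apply: gA; exact: phiAC.
- move=> [xyz|[/= ACx ACy nA ->]] [xyz'|[/= ACx' ACy' nA' ->]] //.
  + exact: Afun xyz xyz'.
  + by case: nA'; have [] := Aran _ _ _ xyz.
  + by case: nA; have [] := Aran _ _ _ xyz'.
- move=> [xyz|[/= ACx ACy nA ->]] [xyz'|[/= ACx' ACy' nA' zz]].
  + exact: Ainj xyz xyz'.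
  + have [_ _] := Aran _ _ _ xyz.
    by rewrite zz => /(jC _ (gA _ _ (phiAC _ ACx') (phiAC _ ACy'))).
  + have [_ _] := Aran _ _ _ xyz'.
    by move=> /(jC _ (gA _ _ (phiAC _ ACx) (phiAC _ ACy))).
  + have Q u : (A `|` C) u -> ~ A u -> A (k u) by move=> [//|/kP[]].
    have R u v : (A `|` C) u -> (A `|` C) v -> ~ A u -> ~ A v ->
      k u = k v -> u = v.
      by move=> [//|/kP[_ ju]] [//|/kP[_ jv]] _ _ kk; rewrite -ju -jv kk.
    have phiR u v : (A `|` C) u -> (A `|` C) v -> phi k u = phi k v -> u = v.
      by move=> ACu ACv; apply: phi_inj; [exact: Q|exact: Q|exact: R].
    have gg := jinj _ _ (gA _ _ (phiAC _ ACx) (phiAC _ ACy))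
      (gA _ _ (phiAC _ ACx') (phiAC _ ACy')) zz.
    have [/phiR-> // /phiR-> //] := ginj _ _ _ _ (phiAC _ ACx) (phiAC _ ACy)
      (phiAC _ ACx') (phiAC _ ACy') gg.
Qed.

(** Nested pairing separates sequences of equal length, so the length is recorded as well. *)
Lemma infinite_seq_inj {T : Type} : infinite_set [set: T] ->
  exists f : seq T -> T, injective f.
Proof.
move=> Tinf; have [t0 _] := infinite_setN0 Tinf.
have [e [_ einj]] := card_le_fun_inj t0 (iffLR (infiniteP _) Tinf).
have {}einj m n : e m = e n -> m = n by exact: einj.
have [p pinj] := infinite_square_inj Tinf.
pose q := foldr (fun x y => p (x, y)) t0.
have qinj s t : size s = size t -> q s = q t -> s = t.
  by elim: s t => [|x s IH] [|y t] //= [/IH st] /pinj[-> /st ->].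
exists (fun s => p (e (size s), q s)) => s t /pinj/pair_equal_spec[/einj st].
exact: qinj.
Qed.

Lemma countable_enum {T : Type} (A : set T) (a0 : T) : countable A ->
  exists f : nat -> T, forall x, A x -> exists n, f n = x.
Proof.
move=> /countable_injP[g ginj].
have /choice[f fP] : forall n, exists x, forall y, A y -> g y = n -> x = y.
  move=> n; have [[x [Ax gx]]|nx] := pselect (exists x, A x /\ g x = n).
    by exists x => y Ay gy; apply: ginj; rewrite ?gx ?gy//; exact/mem_set.
  by exists a0 => y Ay gy; case: nx; exists y.
by exists f => x Ax; exists (g x); exact: fP.
Qed.

Lemma countable_image_factor {T U V : Type} (X : set T) (p : T -> U) (q : T -> V) :
  (forall x y, X x -> X y -> p x = p y -> q x = q y) ->
  countable (p @` X) -> countable (q @` X).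
Proof.
move=> pq cp; have [->|/set0P[x0 Xx0]] := eqVneq X set0.
  by rewrite image_set0; exact: countable0.
have /choice[r rP] : forall u, exists v, forall x, X x -> p x = u -> q x = v.
  move=> u; have [[x [Xx xu]]|nx] := pselect (exists x, X x /\ p x = u).
    by exists (q x) => y Xy yu; apply: pq; rewrite // xu.
  by exists (q x0) => x Xx xu; case: nx; exists x.
apply: (sub_countable (card_le_trans (subset_card_le _) (card_image_le r _)) cp).
by move=> _ [x Xx <-]; exists (p x); [exists x|rewrite -(rP _ _ Xx erefl)].
Qed.

Lemma countable_preimage {T U : Type} (X : set T) (p : T -> U) :
  (forall x y, X x -> X y -> p x = p y -> x = y) ->
  countable (p @` X) -> countable X.
Proof. by move=> pinj; rewrite -{2}[X]image_id; exact: countable_image_factor. Qed.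

(** * Strong measure zero sets *)

Section ternary.
Import Order.TTheory GRing.Theory Num.Theory.
Local Open Scope ring_scope.
Context {R : realType}.
Implicit Types b c : nat -> bool.

Let t n : R := 3^-1 ^+ n.

Let t_gt0 n : 0 < t n.
Proof. by rewrite exprn_gt0// invr_gt0. Qed.

Let tS n : t n = 3 * t n.+1.
Proof. by rewrite /t exprS mulrA mulfV ?mul1r. Qed.

Let psum b n : R := \sum_(i < n) (b i)%:R * (2 * t i.+1).

Let psumS b n : psum b n.+1 = psum b n + (b n)%:R * (2 * t n.+1).
Proof. by rewrite /psum big_ord_recr. Qed.

(** The bound telescopes, since a digit at [i] adds at most [2 * t i.+1 = t i - t i.+1]. *)
Let psum_le b n k : psum b n <= psum b (k + n) <= psum b n + t n - t (k + n).
Proof.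
elim: k => [|k /andP[IH1 IH2]]; first by rewrite add0n addrK lexx.
rewrite addSn psumS; have := tS (k + n); have := t_gt0 (k + n).+1.
by case: (b _) => /= ? ?; rewrite ?(mul1r, mul0r); apply/andP; split; lra.
Qed.

Definition ternary b : R := sup (range (psum b)).

Lemma ternary_bound b n : psum b n <= ternary b <= psum b n + t n.
Proof.
have ub m : psum b m <= psum b n + t n.
  have [/subnK <-|/ltnW/subnK mn] := leqP n m.
    have /andP[_ ] := psum_le b n (m - n); have := t_gt0 (m - n + n); lra.
  have := psum_le b m (n - m); rewrite mn => /andP[? _].
  have := t_gt0 n; lra.
apply/andP; split.
  apply: ub_le_sup; last by exists n.
  by exists (psum b n + t n) => _ [m _ <-].
by apply: ge_sup; [exists (psum b 0), 0|move=> _ [m _ <-]].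
Qed.

Let psum_eq b c n : (forall i, (i < n)%N -> b i = c i) -> psum b n = psum c n.
Proof. by move=> bc; apply: eq_bigr => i _; rewrite bc. Qed.

Lemma ternary_near b c n : (forall i, (i < n)%N -> b i = c i) ->
  ternary c - 3^-1 ^+ n <= ternary b <= ternary c + 3^-1 ^+ n.
Proof.
move=> /psum_eq bc; have := ternary_bound b n; have := ternary_bound c n.
by rewrite bc -/(t n) => /andP[? ?] /andP[? ?]; apply/andP; split; lra.
Qed.

(** At the first difference [n] the digits are [2 * t n.+1] apart, while the later digits add at
    most [t n.+1]. *)
Lemma ternary_inj : injective ternary.
Proof.
suff lt b c n : (forall i, (i < n)%N -> b i = c i) -> b n = false -> c n ->
    ternary b < ternary c.
  move=> b c bc; apply/funext => n; apply: contrapT => /eqP.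
  have [m] := ubnP n; elim: m n => // m IH n nm bcn.
  have [[i [ni bci]]|noi] :=
      pselect (exists i, (i < n)%N /\ b i != c i).
    by apply: (IH i) => //; exact: leq_trans ni nm.
  have {}noi i : (i < n)%N -> b i = c i.
    by move=> ni; apply/eqP; apply: contrapT => /negP ?; apply: noi; exists i.
  case bn : (b n) bcn; case cn : (c n) => // _.
    by have := lt c b n (fun i ni => esym (noi i ni)) cn bn; rewrite bc ltxx.
  by have := lt b c n noi bn cn; rewrite bc ltxx.
move=> /psum_eq bc bn cn; have := ternary_bound b n.+1.
have := ternary_bound c n.+1; rewrite !psumS bn cn bc mul1r mul0r.
by have := t_gt0 n.+1 => ? /andP[? ?] /andP[? ?]; lra.
Qed.

Lemma exp3_small (e : R) : 0 < e -> exists n : nat, 2 * 3^-1 ^+ n <= e.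
Proof.
move=> e0; exists (Num.bound (2 / e)); set n := Num.bound _.
have n3 : 2 / e < 3 ^+ n.
  apply: lt_le_trans (archi_boundP _) _; first by rewrite divr_ge0// ltW.
  by rewrite -natrX ler_nat ltnW// ltn_expl.
rewrite exprVn ler_pdivrMr ?exprn_gt0// mulrC -ler_pdivrMr//.
exact: ltW.
Qed.

End ternary.

(* Strong measure zero subsets of the Cantor space, where [n k] is the number of
   coordinates that the [k]-th ball fixes. *)
Definition smz_cantor (X : set (nat -> bool)) := forall n : nat -> nat,
  exists a : nat -> nat -> bool,
    forall x, X x -> exists k, forall i, i < n k -> x i = a k i.

Lemma smz_cantor_countable (X : set (nat -> bool)) :
  BorelConjecture -> smz_cantor X -> countable X.
Proof.
move=> BC smzX; pose w := @ternary Rdefinitions.R.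
suff : countable (w @` X).
  move=> /countable_injP[f finj]; apply/countable_injP; exists (f \o w).
  move=> x y /set_mem Xx /set_mem Xy /= fxy; apply: (@ternary_inj Rdefinitions.R).
  by apply: finj => //; apply/mem_set; [exists x|exists y].
apply: BC => eps eps0.
have /choice[n nP] k := exp3_small (eps0 k).
have [a aP] := smzX n.
(* The interval is centered at [w (a k)] with radius [3^-1 ^+ n k] on the left; [n k] makes twice
   this radius at most [eps k]. *)
exists (fun k => w (a k) - 3^-1 ^+ n k)%R => _ [x Xx <-].
have [k xk] := aP _ Xx; exists k => //=; rewrite in_itv /=.
have /andP[-> wx] /= := ternary_near (R := Rdefinitions.R) xk.
by have := nP k; rewrite -/w in wx *; lra.
Qed.

(* A function is coded by the set of its finite initial segments, so that the
   closure of the codes only adds the codes of the finite sequences. *)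
Definition prefix_code (f : nat -> nat) : nat -> bool := fun m =>
  if unpickle m is Some s then s == mkseq f (size s) else false.

Definition seq_code (s : seq nat) : nat -> bool := fun m =>
  if unpickle m is Some t then prefix t s else false.

Lemma prefix_code_inj : injective prefix_code.
Proof.
move=> f g fg; apply/funext => n.
have := congr1 (@^~ (pickle (mkseq f n.+1))) fg.
rewrite /prefix_code pickleK size_mkseq eqxx => /esym/eqP.
by move=> /(congr1 (fun s => nth 0 s n)); rewrite !nth_mkseq.
Qed.

(** A bit of the code depends on as many values of [f] as the tested sequence is long, and finitely
    many bits have a common bound. *)
Lemma prefix_code_near n : exists N, forall f g : nat -> nat,
  (forall i, i < N -> f i = g i) ->
  forall i, i < n -> prefix_code f i = prefix_code g i.
Proof.
pose len i := if unpickle i is Some s then size (s : seq nat) else 0.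
exists (\max_(i < n) len i) => f g fg i ni.
rewrite /prefix_code; case E : (unpickle i) => [s|//].
congr (_ == _); apply/eq_in_map => j; rewrite mem_iota add0n => /= js.
apply: fg; apply: leq_trans js _.
by have := @leq_bigmax 'I_n (fun i => len i) (Ordinal ni); rewrite /= {1}/len E.
Qed.

(** A large value of [f] right after [s] rules out the finitely many tested sequences that are
    longer than [s]; the others cannot tell [f] from [s]. *)
Lemma seq_code_near n (s : seq nat) : exists N, forall f : nat -> nat,
  mkseq f (size s) = s -> N <= f (size s) ->
  forall i, i < n -> prefix_code f i = seq_code s i.
Proof.
pose val i := if unpickle i is Some t then (nth 0 t (size s)).+1 else 0.
exists (\max_(i < n) val i) => f fs Nf i ni.
rewrite /prefix_code /seq_code; case E : (unpickle i) => [t|//].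
have [ts|st] := leqP (size t) (size s).
  rewrite prefixE -fs /mkseq -map_take take_iota (minn_idPl ts) -/(mkseq f _).
  by rewrite eq_sym.
have -> : prefix t s = false.
  by apply: contraTF st => /size_prefix; rewrite -leqNgt.
apply/negP => /eqP tE; move: Nf; apply/negP; rewrite -ltnNge.
have := @leq_bigmax 'I_n (fun i => val i) (Ordinal ni).
by rewrite /= {1}/val E tE nth_mkseq.
Qed.

(* Covering neighborhoods of all finite sequences [s] leaves only functions [f]
   with [f i < N (mkseq f i)], and these are bounded by a single [b]. *)
Lemma smz_prefix_code (Y : set (nat -> nat)) :
  (forall b : nat -> nat, countable [set f | Y f /\ forall i, f i <= b i]) ->
  smz_cantor (prefix_code @` Y).
Proof.
move=> Ybd n.
(* The ball of index [(pickle s).*2] is reserved for [s]; those of odd index serve the functions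
   bounded by [b]. *)
have /choice[N NP] s := seq_code_near (n (pickle s).*2) s.
pose bd L := \max_(s <- L) N s.
(* Finite levels of a tree that contains all initial segments of the functions left uncovered. *)
pose L := fix L i := if i is j.+1 then
  [seq rcons s k | s <- L j, k <- iota 0 (bd (L j))] else [:: [::]].
pose b i := bd (L i).
have [e eP] := countable_enum (fun=> 0) (Ybd b).
exists (fun k => if odd k then prefix_code (e k./2)
  else seq_code (odflt [::] (unpickle k./2))).
move=> _ [f Yf <-].
have [[i Nfi]|fN] := pselect (exists i, N (mkseq f i) <= f i).
  exists (pickle (mkseq f i)).*2 => j; rewrite odd_double doubleK pickleK /=.
  by apply: NP; rewrite size_mkseq.
have {}fN i : f i < N (mkseq f i).
  by rewrite ltnNge; apply/negP => Nfi; apply: fN; exists i.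
have leN (M : seq (seq nat)) s : s \in M -> N s <= bd M.
  by move=> sM; exact: (leq_bigmax_seq (P := predT)).
have fL i : mkseq f i \in L i.
  elim: i => [|i IH]; first by rewrite inE.
  rewrite mkseqS; apply/allpairsPdep.
  exists (mkseq f i), (f i); rewrite IH mem_iota add0n; split=> //=.
  exact: leq_trans (fN i) (leN _ _ IH).
have [k ekf] : exists k, e k = f.
  apply: eP; split=> // i; apply: ltnW; exact: leq_trans (fN i) (leN _ _ (fL i)).
by exists k.*2.+1 => j _; rewrite /= odd_double uphalf_double ekf.
Qed.

(** * Uniformities with a countable base *)

Section uniform.
Variables (T : Type) (X : set T) (E : nat -> T -> T -> Prop).
Hypothesis Erefl : forall n x, E n x x.
Hypothesis Esym : forall n x y, E n x y -> E n y x.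
Hypothesis Etrans : forall n x y z, E n.+1 x y -> E n.+1 y z -> E n x z.

Lemma entourage_decr m n x y : m <= n -> E n x y -> E m x y.
Proof.
move=> /subnK <-; elim: (n - m) => [|k IH] //.
by rewrite addSn => Exy; apply: IH; exact: Etrans Exy (Erefl _ _).
Qed.

Definition entourage_class x := [set y | X y /\ forall n, E n x y].

(** Transitivity costs one index, which is harmless when all indices are required. *)
Lemma entourage_class_eqP x y : X y ->
  entourage_class x = entourage_class y <-> forall n, E n x y.
Proof.
move=> Xy; split=> [xy|Exy].
  by have [] : entourage_class x y by rewrite xy.
apply/seteqP; split=> z [Xz Ez]; split=> // n.
  exact: Etrans (Esym (Exy n.+1)) (Ez _).
exact: Etrans (Exy n.+1) (Ez _).
Qed.

Hypothesis Eroth : forall M : nat -> nat, exists g : nat -> T,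
  forall x, X x -> exists k, E (M k) (g k) x.

Lemma countable_entourage_classes :
  BorelConjecture -> countable (entourage_class @` X).
Proof.
move=> BC.
(* Balls of the finer [E n.+1] cover [X], so each point of [X] is interior to some [E n] ball. *)
have /choice[g gP] n := Eroth (fun=> n.+1).
pose O n i := [set x | exists m, forall y, E m x y -> E n (g n i) y].
have /choice[h hP] x : exists h : nat -> nat, X x ->
    forall n, O n (h n) x /\ forall i, O n i x -> h n <= i.
  have [Xx|nX] := pselect (X x); last by exists (fun=> 0).
  suff /choice[h hP] : forall n, exists i, O n i x /\ forall j, O n j x -> i <= j.
    by exists h.
  move=> n; have exO : exists i, `[< O n i x >].
    have [i gi] := gP n x Xx; exists i; apply/asboolP; exists n.+1 => y.
    exact: Etrans.
  exists (ex_minn exO); case: ex_minnP => i /asboolP Oi imin; split=> // j Oj.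
  by apply: imin; exact/asboolP.
have /choice[mu muP] x : exists m : nat -> nat, X x ->
    forall n y, E (m n) x y -> O n (h x n) y.
  have [Xx|nX] := pselect (X x); last by exists (fun=> 0).
  (* The successor puts the whole ball around [x] into the interior [O n (h x n)], not merely into
     the ball of [g]. *)
  have /choice[m mP] n := (hP x Xx n).1; exists (fun n => (m n).+1) => _ n y Exy.
  by exists (m n).+1 => z Eyz; apply: mP; exact: Etrans Exy Eyz.
have bounded (b : nat -> nat) :
    countable (h @` [set x | X x /\ forall n, mu x n <= b n]).
  set Y := [set x | _].
  (* Each point lies in the set [O] chosen for the other, and both indices are minimal. *)
  have Yh n x y : Y x -> Y y -> E (b n) x y -> h x n = h y n.
    move=> [Xx xb] [Xy yb] Exy; apply/eqP; rewrite eqn_leq; apply/andP; split.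
      apply: (hP x Xx n).2; apply: (muP y Xy); apply: Esym.
      exact: entourage_decr (yb n) Exy.
    apply: (hP y Xy n).2; apply: (muP x Xx).
    exact: entourage_decr (xb n) Exy.
  apply: (@countable_preimage _ _ _ prefix_code) => [f f' _ _|].
    exact: prefix_code_inj.
  apply: smz_cantor_countable => // n.
  have /choice[N NP] k := prefix_code_near (n k).
  (* The successor pays for replacing the center [a k] by a point [r k] of [Y]. *)
  pose M k := (\max_(i < N k) b i).+1.
  have [a aP] := Eroth M.
  have /choice[r rP] : forall k, exists r, forall x, Y x -> E (M k) (a k) x ->
      Y r /\ E (M k) (a k) r.
    move=> k; have [[r rY]|nr] := pselect (exists r, Y r /\ E (M k) (a k) r).
      by exists r.
    by exists (a k) => x Yx Ex; case: nr; exists x.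
  exists (fun k => prefix_code (h (r k))) => _ [_ [x Yx <-] <-].
  have [k kx] := aP _ Yx.1; exists k; apply: NP => i iN.
  have [Yr kr] := rP _ _ Yx kx.
  apply: Yh => //; apply: (@entourage_decr _ (M k).-1).
    by have := @leq_bigmax 'I_(N k) (fun i => b i) (Ordinal iN).
  exact: Etrans (Esym kx) kr.
have /choice[s sP] : forall u, exists z, forall x, X x -> h x = u -> X z /\ h z = u.
  move=> u; have [[z zu]|nz] := pselect (exists z, X z /\ h z = u); first by exists z.
  exists (g 0 0) => x Xx xu.
  by case: nz; exists x.
pose Z := [set z | X z /\ s (h z) = z].
have hZ x y : Z x -> Z y -> h x = h y -> x = y.
  by move=> [_ {2}<-] [_ {2}<-] ->.
(* Since [mu] may identify points of [Z], its fibres are counted too: each is bounded by its own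
   modulus. *)
have Zmu f : countable [set z | Z z /\ mu z = f].
  apply: (@countable_preimage _ _ _ h) => [x y [Zx _] [Zy _]|]; first exact: hZ.
  apply: (sub_countable (subset_card_le _) (bounded f)) => _ [z [Zz <-] <-].
  by exists z => //; split=> //; exact: Zz.1.
have cZmu : countable (mu @` Z).
  apply: (@countable_preimage _ _ _ prefix_code) => [f f' _ _|].
    exact: prefix_code_inj.
  apply: smz_cantor_countable => //; apply: smz_prefix_code => b.
  have bZ : countable [set z | Z z /\ forall n, mu z n <= b n].
    apply: (@countable_preimage _ _ _ h) => [x y [Zx _] [Zy _]|]; first exact: hZ.
    apply: (sub_countable (subset_card_le _) (bounded b)) => _ [z [Zz zb] <-].
    by exists z => //; split=> //; exact: Zz.1.
  apply: (sub_countable (card_le_trans (subset_card_le _) (card_image_le mu _)) bZ).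
  by move=> _ [[z Zz <-] zb]; exists z.
have cZ : countable Z.
  have -> : Z = \bigcup_(f in mu @` Z) [set z | Z z /\ mu z = f].
    apply/seteqP; split=> [z Zz|z [_ _ []//]].
    by exists (mu z); [exists z|].
  exact: bigcup_countable.
(* Points with the same [h] share an [E n.+1] ball for every [n], hence a class. *)
apply: (@countable_image_factor _ _ _ X (s \o h)) => [x y Xx Xy /= sxy|].
  have [_ hx] := sP _ x Xx erefl; have [_ hy] := sP _ y Xy erefl.
  have hxy : h x = h y by rewrite -hx sxy hy.
  apply/entourage_class_eqP => // n.
  have Eg z : X z -> E n.+1 (g n.+1 (h z n.+1)) z.
    by move=> Xz; have [m] := (hP z Xz n.+1).1; apply; exact: Erefl.
  by apply: Etrans (Esym (Eg _ Xx)) _; rewrite hxy; exact: Eg.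
apply: (sub_countable (subset_card_le _) cZ) => _ [x Xx <-] /=.
by have [? hx] := sP _ x Xx erefl; split=> //; rewrite hx.
Qed.

End uniform.

(** * Topological groups *)

Section group.
Variables (G : topologicalType) (mul : G -> G -> G) (inv : G -> G) (e : G).
Hypothesis Ggrp : topological_group mul inv e.

Let mulA : associative mul. Proof. by have [[]] := Ggrp. Qed.
Let mul1 : left_id e mul. Proof. by have [[]] := Ggrp. Qed.
Let mulV : left_inverse e inv mul. Proof. by have [[]] := Ggrp. Qed.
Let mul_cont : continuous (fun p : G * G => mul p.1 p.2).
Proof. by have [_ []] := Ggrp. Qed.
Let inv_cont : continuous inv. Proof. by have [_ []] := Ggrp. Qed.

Let mulKV x y : mul (inv x) (mul x y) = y.
Proof. by rewrite mulA mulV mul1. Qed.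

Let mul_injl x y z : mul x y = mul x z -> y = z.
Proof. by move=> xyz; rewrite -(mulKV x y) xyz mulKV. Qed.

Lemma group_mulr1 x : mul x e = x.
Proof. by apply: (@mul_injl (inv x)); rewrite mulKV mulV. Qed.

Let mulrV x : mul x (inv x) = e.
Proof. by apply: (@mul_injl (inv x)); rewrite mulKV group_mulr1. Qed.

Lemma group_mulVK x y : mul x (mul (inv x) y) = y.
Proof. by rewrite mulA mulrV mul1. Qed.

Let invM x y : inv (mul x y) = mul (inv y) (inv x).
Proof.
by apply: (@mul_injl (mul x y)); rewrite mulrV -mulA group_mulVK mulrV.
Qed.

Let invK x : inv (inv x) = x.
Proof. by apply: (@mul_injl (inv x)); rewrite mulrV mulV. Qed.

Let inve : inv e = e.
Proof. by rewrite -[LHS]mul1 mulrV. Qed.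

(** Continuity of [mul] at [(e, e)] gives the square root; intersecting with its inverse makes it
    symmetric. *)
Lemma square_root_nbhs (W : set G) : open_nbhs e W ->
  exists V, [/\ open_nbhs e V, forall a, V a -> V (inv a) &
    forall a b, V a -> V b -> W (mul a b)].
Proof.
move=> We; have : nbhs (mul e e) W by rewrite mul1; exact: open_nbhs_nbhs.
move=> /(mul_cont (x := (e, e)))[[A B] /= [Ae Be] ABW].
have : nbhs e (A `&` B) by exact: filterI.
rewrite nbhsE => -[V Ve VAB]; exists (V `&` inv @^-1` V); split.
- split; last by split; rewrite /= ?inve; exact: Ve.2.
  apply: openI; first exact: Ve.1.
  by apply: open_comp => [x _|]; [exact: inv_cont|exact: Ve.1].
- by move=> a [Va Via]; split=> //=; rewrite invK.
- by move=> a b [/VAB[Aa _] _] [/VAB[_ Bb] _]; exact: (ABW (a, b)).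
Qed.

Lemma group_chain (V : nat -> set G) : (forall n, open_nbhs e (V n)) ->
  exists U : nat -> set G, [/\ forall n, open_nbhs e (U n),
    forall n a, U n a -> U n (inv a),
    forall n a b, U n.+1 a -> U n.+1 b -> U n (mul a b) &
    forall n, U n `<=` V n].
Proof.
move=> Ve.
have /choice[next nextP] W : exists V', open_nbhs e W ->
    [/\ open_nbhs e V', forall a, V' a -> V' (inv a) &
    forall a b, V' a -> V' b -> W (mul a b)].
  have [/square_root_nbhs[V' V'P]|nW] := pselect (open_nbhs e W).
    by exists V'.
  by exists setT.
(* The square of each term falls into both [V n] and the previous term. *)
pose U := fix U n := next (V n `&` if n is m.+1 then U m else setT).
have Ue n : open_nbhs e (U n).
  elim: n => [|n IH] /=.
    by have [] := nextP _ (open_nbhsI (Ve 0) (open_nbhsT e)).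
  by have [] := nextP _ (open_nbhsI (Ve n.+1) IH).
have UP n := nextP _ (open_nbhsI (Ve n)
  (if n is m.+1 return open_nbhs e (if n is m.+1 then U m else setT)
   then Ue m else open_nbhsT e)).
exists U; split=> // [[|n] a|n a b Ua Ub|[|n] a Ua].
- by have [_ + _] := UP 0; exact.
- by have [_ + _] := UP n.+1; exact.
- by have [_ _ /(_ a b Ua Ub)[]] := UP n.+1.
- have [[_ Ue0] _ /(_ a e Ua Ue0)[]] := UP 0.
  by rewrite group_mulr1.
- have [[_ Ue0] _ /(_ a e Ua Ue0)[]] := UP n.+1.
  by rewrite group_mulr1.
Qed.

(** Left translates of [U n] are balls of the left uniformity, so the covering condition of the
    previous section holds; [c] numbers the classes. *)
Lemma rothberger_bounded_code (X : set G) (V : nat -> set G) :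
  BorelConjecture -> rothberger_bounded mul e X ->
  (forall n, open_nbhs e (V n)) ->
  exists (U : nat -> set G) (c : G -> nat),
    [/\ forall n, open_nbhs e (U n), forall n, U n `<=` V n &
      forall x y, X x -> X y -> c x = c y <-> forall n, U n (mul (inv x) y)].
Proof.
move=> BC XR /group_chain[U [Ue Uinv Umul UV]].
pose E n x y := U n (mul (inv x) y).
have Erefl n x : E n x x by rewrite /E mulV; exact: (Ue n).2.
have Esym n x y : E n x y -> E n y x.
  by move=> /Uinv; rewrite invM invK.
have Etrans n x y z : E n.+1 x y -> E n.+1 y z -> E n x z.
  by move=> Exy Eyz; rewrite /E -(group_mulVK y z) mulA; exact: Umul.
have Eroth (M : nat -> nat) : exists g : nat -> G,
    forall x, X x -> exists k, E (M k) (g k) x.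
  have [g Xg] := XR _ (fun k => Ue (M k)); exists g => x /Xg[k _ [u Uu <-]].
  by exists k; rewrite /E mulKV.
have /countable_injP[d dinj] :=
  countable_entourage_classes Erefl Esym Etrans Eroth BC.
exists U, (d \o entourage_class X E); split=> // x y Xx Xy /=.
rewrite -(entourage_class_eqP Erefl Esym Etrans x Xy); split=> [|->//].
by apply: dinj; apply/mem_set; [exists x|exists y].
Qed.

End group.

Lemma nKH_BC_kappa (K : Type) : ~ countable [set: K] ->
  BorelConjecture -> ~ KH K -> BC_kappa K.
Proof.
move=> Kunc BC nKH G mul inv e Ggrp _ [[BB [BBopen BBbasis] BBK] _] X XR.
apply: contrapT => XK; apply: nKH.
have Kinf : infinite_set [set: K] by move=> /finite_set_countable.
have [k0 _] := infinite_setN0 Kinf.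
have [p pinj] := infinite_square_inj Kinf.
have [i [_ iinj]] := card_le_fun_inj k0 (iffLR (infiniteP _) Kinf).
have {}iinj m n : i m = i n -> m = n by exact: iinj.
have [j [_ jinj]] := card_le_fun_inj k0 BBK.
pose BBe := [set B | BB B /\ B e].
have eB V : open_nbhs e V -> exists2 B, BBe B & B `<=` V.
  by move=> /open_nbhs_nbhs /BBbasis[B BBB BV]; exists B.
(* The graphs live in [K] through this coding of pairs, which [q] decodes. *)
pose iota B n := p (j B, i n).
have /choice[q qP] k : exists q, forall B n, BBe B -> iota B n = k -> q = (B, n).
  have [[B [n [BBB <-]]]|nk] := pselect (exists B n, BBe B /\ iota B n = k).
    exists (B, n) => B' n' BBB' /pinj/pair_equal_spec[/jinj BB' /iinj nn'].
    by rewrite (BB' BBB'.1 BBB.1) nn'.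
  by exists (set0, 0) => B n BBB Bn; case: nk; exists B, n.
have /choice[Uc UcP] B : exists Uc : (nat -> set G) * (G -> nat), BBe B ->
    [/\ forall n, open_nbhs e (Uc.1 n), forall n, Uc.1 n `<=` B &
      forall x y, X x -> X y ->
        Uc.2 x = Uc.2 y <-> forall n, Uc.1 n (mul (inv x) y)].
  have [[BB_B Be]|nB] := pselect (BBe B); last by exists (fun=> set0, fun=> 0).
  have [//|U [c Uc]] := rothberger_bounded_code (V := fun=> B) Ggrp BC XR.
    by move=> _; split=> //; exact: BBopen.
  by exists (U, c).
pose S x := [set k | exists2 B, BBe B & k = iota B ((Uc B).2 x)].
have SP x y B : BBe B -> S x (iota B ((Uc B).2 y)) -> (Uc B).2 y = (Uc B).2 x.
  move=> BBB [B' BBB' BB']; have := qP _ _ _ BBB' (esym BB').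
  by rewrite (qP _ _ _ BBB erefl) => /pair_equal_spec[<-].
have Sinj x y : X x -> X y -> S x = S y -> x = y.
  move=> Xx Xy Sxy; apply: contrapT => xy.
  have : mul (inv x) y != e.
    apply: contra_notN xy => /eqP xye.
    by rewrite -[y](group_mulVK Ggrp x) xye (group_mulr1 Ggrp).
  (* T1 gives a basic [B] omitting [mul (inv x) y], but equal values at [B] would put this element
     into [B]. *)
  have [_ [_ _ [_ acc]]] := Ggrp; rewrite eq_sym => /acc[V [Vo Ve Vxy]].
  have [B BBB BV] := eB V (conj Vo (set_mem Ve)).
  have [_ UB cB] := UcP _ BBB.
  have /cB xyU : (Uc B).2 x = (Uc B).2 y.
    by apply: (SP y x B BBB); rewrite -Sxy; exists B.
  by apply: (set_mem Vxy); apply/BV/(UB 0); exact: xyU.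
exists (S @` X); split.
  move=> SK; apply: XK; apply: card_le_trans SK.
  by apply: (@card_le_of_inj _ _ _ _ S) => [x Xx|]; [exists x|exact: Sinj].
move=> A cA _.
have [B0 BBB0 _] := eB _ (open_nbhsT e).
pose A' := [set B | BBe B /\ exists n, A (iota B n)].
have cA' : countable A'.
  apply: (sub_countable (card_le_trans (subset_card_le _)
    (card_image_le (fst \o q) _)) cA).
  by move=> B [BBB [n ABn]]; exists (iota B n) => //=; rewrite (qP _ _ _ BBB erefl).
have [f fP] := countable_enum B0 cA'.
pose f' n := if pselect (BBe (f n)) then f n else B0.
have f'e n : BBe (f' n) by rewrite /f'; case: pselect.
have f'P B : A' B -> exists n, f' n = B.
  move=> A'B; have [n fn] := fP _ A'B; exists n; rewrite /f' fn.
  by case: pselect => //; case: A'B.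
(* The chains of the countably many [B] that [A] meets are merged into one sequence; a single chain
   below it determines all traces on [A]. *)
pose V m := if unpickle m is Some nk then (Uc (f' nk.1)).1 nk.2 else setT.
have Ve m : open_nbhs e (V m).
  rewrite /V; case: unpickle => [nk|]; last exact: open_nbhsT.
  by have [] := UcP _ (f'e nk.1).
have [U [c [_ UV cP]]] := rothberger_bounded_code Ggrp BC XR Ve.
rewrite image_comp; apply: (@countable_image_factor _ _ _ X c); last exact: countableP.
suff sub x y : X x -> X y -> c x = c y -> S x `&` A `<=` S y `&` A.
  by move=> x y Xx Xy cxy; apply/seteqP; split; apply: sub.
move=> Xx Xy /(cP _ _ Xx Xy) Uxy k [[B BBB kB] Ak]; split=> //.
exists B => //; rewrite kB; congr (iota B _).
have [n fnB] : exists n, f' n = B.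
  by apply: f'P; split=> //; exists ((Uc B).2 x); rewrite -kB.
have [_ _ cB] := UcP _ BBB; apply/cB => // m.
by have := UV _ _ (Uxy (pickle (n, m))); rewrite /V pickleK /= fnB.
Qed.

(** * The Cantor cube *)

Section cantor.
Variable K : Type.
Implicit Types (s : seq (K * bool)) (x y : Cantor K).

(** With lists of constraints, intersection is concatenation, and cylinders can be counted by
    [infinite_seq_inj]. *)
Definition cylinder s : set (Cantor K) :=
  foldr (fun p A => [set x | x p.1 = p.2] `&` A) setT s.

Definition support s : set K := foldr (fun p A => p.1 |` A) set0 s.

Lemma cylinder_cat s t : cylinder (s ++ t) = cylinder s `&` cylinder t.
Proof. by elim: s => [|p s IH] /=; rewrite ?setTI// IH setIA. Qed.

Lemma cylinder_eq s x y :
  (forall k, support s k -> x k = y k) -> cylinder s x -> cylinder s y.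
Proof.
elim: s => [|p s IH] //= xy [xp sx]; split; last first.
  by apply: IH sx => k sk; apply: xy; right.
by rewrite /= -xy//; left.
Qed.

Lemma finite_support s : finite_set (support s).
Proof.
elim: s => [|p s IH] /=; first exact: finite_set0.
by rewrite finite_setU; split=> //; exact: finite_set1.
Qed.

Lemma cantor_eval_continuous (k : K) : continuous (fun x : Cantor K => x k).
Proof.
move=> x; have /cvg_sup/(_ k) : x --> x by exact: cvg_id.
move=> xx; apply: cvg_trans (@initial_continuous _ bool (fun f : K -> bool => f k) x).
by apply: cvg_app.
Qed.

Lemma open_cylinder s : open (cylinder s).
Proof.
elim: s => [|p s IH] /=; first exact: openT.
apply: openI => //.
have -> : [set x | x p.1 = p.2] = (fun x : Cantor K => x p.1) @^-1` [set p.2] by [].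
apply: open_comp => [x _|]; last exact: discrete_open.
exact: cantor_eval_continuous.
Qed.

(** The filter generated by the cylinders around [x] converges to [x], as the product topology lets
    convergence be tested coordinatewise. *)
Lemma nbhs_cylinder x (U : set (Cantor K)) : nbhs x U ->
  exists2 s, cylinder s x & cylinder s `<=` U.
Proof.
move: U; pose F := filter_from [set s | cylinder s x] cylinder.
have FF : Filter F.
  apply: filter_from_filter; first by exists [::].
  move=> s t sx tx; exists (s ++ t); rewrite /= ?cylinder_cat//.
suff : F --> x by [].
apply/cvg_sup => k U; rewrite nbhsE => -[_ [[V _ <-] Vx] VU].
exists [:: (k, x k)] => //= y [yk _]; apply: VU.
by rewrite /preimage /= yk.
Qed.

Lemma cantor_addC x y : cantor_add x y = cantor_add y x.
Proof. by apply/funext => k; exact: addbC. Qed.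

Lemma cantor_addA : associative (@cantor_add K).
Proof. by move=> x y z; apply/funext => k; exact: addbA. Qed.

Lemma cantor_add0 : left_id (cantor_zero K) (@cantor_add K).
Proof. by move=> x; apply/funext => k; exact: addFb. Qed.

Lemma cantor_addxx x : cantor_add x x = cantor_zero K.
Proof. by apply/funext => k; exact: addbb. Qed.

Lemma cantor_addK x y : cantor_add x (cantor_add x y) = y.
Proof. by rewrite cantor_addA cantor_addxx cantor_add0. Qed.

(** Let [f] enumerate the restrictions to the union [A] of all supports. If [x] restricts to [f n],
    their sum vanishes on the support of [s n]. *)
Lemma countable_restrictions_rothberger (H : set (Cantor K)) :
  (forall A : set K, countable A ->
    countable ((fun x k => x k && `[< A k >]) @` H)) ->
  rothberger_bounded (@cantor_add K) (cantor_zero K) H.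
Proof.
move=> HA U Ue.
have /choice[s sP] n : exists s, cylinder s (cantor_zero K) /\ cylinder s `<=` U n.
  by have [s] := nbhs_cylinder (open_nbhs_nbhs (Ue n)); exists s.
pose A := \bigcup_n support (s n).
have cA : countable A.
  apply: bigcup_countable; first exact: countableP.
  by move=> n _; apply: finite_set_countable; exact: finite_support.
have [f fP] := countable_enum (cantor_zero K : K -> bool) (HA A cA).
exists f => x Hx; have [n fn] := fP _ (imageP _ Hx).
exists n => //; exists (cantor_add (f n) x); last exact: cantor_addK.
apply: (sP n).2; apply: cylinder_eq (sP n).1 => k sk.
rewrite /cantor_add /cantor_zero fn.
have -> : `[< A k >] by apply/asboolP; exists n.
by rewrite andbT addbb.
Qed.

End cantor.

(** The subgroup consists of finite sums of characteristic functions. The trace of a sum is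
    determined by the finite sequence of traces of its terms. *)
Lemma BC_cantor_subgroup_nKH (K : Type) : BC_cantor_subgroup K -> ~ KH K.
Proof.
move=> BCK [F [FK FA]].
pose chi (X : set K) : Cantor K := fun k => `[< X k >].
have chi_inj : injective chi.
  move=> X Y XY; apply/funext => k.
  have XYk : chi X k = chi Y k by rewrite XY.
  exact: propext (asbool_eq_equiv XYk).
pose sum (s : seq (set K)) := foldr (fun X x => cantor_add (chi X) x) (cantor_zero K) s.
pose inF (s : seq (set K)) := foldr (fun X P => F X /\ P) True s.
have sum_cat s t : sum (s ++ t) = cantor_add (sum s) (sum t).
  by elim: s => [|X s IH] /=; rewrite ?cantor_add0// IH cantor_addA.
have inF_cat s t : inF s -> inF t -> inF (s ++ t).
  by elim: s => [|X s IH] //= [FX /IH sF] /sF.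
apply: FK; apply: card_le_trans (BCK (sum @` inF) _ _).
- apply: (@card_le_of_inj _ _ _ _ chi) => [X FX|X Y _ _]; last exact: chi_inj.
  by exists [:: X] => //=; rewrite cantor_addC cantor_add0.
- split; first by exists [::].
  by move=> _ _ [s sF <-] [t tF <-]; exists (s ++ t); [exact: inF_cat|].
apply: countable_restrictions_rothberger => A cA.
have {}FA : countable [set X `&` A | X in F].
  (* The family is controlled on infinite sets only; a finite [A] has countably many subsets
     anyway. *)
  have [finA|] := pselect (finite_set A); last exact: FA.
  apply: (sub_countable (subset_card_le _)
    (countable_finite_subset (finite_set_countable finA))) => _ [X _ <-].
  by split; [exact: subIsetr|exact: finite_setIr].
have /countable_injP[g ginj] := FA.
rewrite image_comp.
apply: (@countable_image_factor _ _ _ _ (map (fun X => g (X `&` A)))); last first.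
  exact: countableP.
elim=> [|X s IH] [|Y t] //= [FX sF] [FY tF] [gXY st].
have XYA : X `&` A = Y `&` A.
  by apply: ginj; rewrite //; apply/mem_set; [exists X|exists Y].
apply/funext => k; have := congr1 (fun f : K -> bool => f k) (IH t sF tF st).
rewrite /= /cantor_add !andb_addl => ->; congr (_ (+) _).
have := congr1 (fun B : set K => `[< B k >]) XYA.
by rewrite /setI /= !asbool_and.
Qed.

(** * The cube as an $\aleph_0$-bounded group of weight [K] *)

Section cantor_group.
Variable K : Type.
Implicit Types (s : seq (K * bool)) (x y : Cantor K).

Lemma nbhs_agree s x : nbhs x [set y | forall k, support s k -> y k = x k].
Proof.
have -> : [set y | forall k, support s k -> y k = x k] =
    cylinder [seq (p.1, x p.1) | p <- s].
  elim: s => [|p s IH] /=; first by apply/seteqP; split=> // y _ k [].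
  rewrite -IH; apply/seteqP; split=> [y xy|y [yp ys] k [->|/ys]] //.
  by split; [apply: xy; left|move=> k sk; apply: xy; right].
apply: open_nbhs_nbhs; split; first exact: open_cylinder.
by elim: s.
Qed.

Lemma cantor_topological_group :
  topological_group (@cantor_add K) id (cantor_zero K).
Proof.
split; split.
- exact: cantor_addA.
- exact: cantor_add0.
- exact: cantor_addxx.
- move=> [x y] U /= /nbhs_cylinder[s sxy sU].
  exists ([set z | forall k, support s k -> z k = x k],
    [set z | forall k, support s k -> z k = y k]).
    by split; exact: nbhs_agree.
  move=> [x' y'] /= [xx' yy']; apply: (sU (cantor_add x' y')).
  apply: cylinder_eq sxy => k sk.
  by rewrite /cantor_add xx'// yy'.
- by move=> x; exact: cvg_id.
(* Complete regularity comes from the product uniformity, T1 from a coordinate where the points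
   differ. *)
split; first exact: (@uniform_completely_regular Rdefinitions.R {ptws K -> bool}).
move=> x y /eqP xy; have [k xyk] : exists k, x k != y k.
  apply: contrapT => /forallNP xyk; apply: xy; apply/funext => k.
  by apply/eqP/negPn/negP; exact: xyk.
exists (cylinder [:: (k, x k)]); split; first exact: open_cylinder.
  by apply/mem_set.
by apply/mem_set => -[/= yxk _]; rewrite yxk eqxx in xyk.
Qed.

Lemma cantor_aleph0_bounded : aleph0_bounded (@cantor_add K) (cantor_zero K).
Proof.
move=> U /open_nbhs_nbhs /nbhs_cylinder[s s0 sU].
pose res (x : K -> bool) k := x k && `[< support s k >].
have cres : countable (range res).
  apply: (@countable_preimage _ _ _ (fun x => [set k | x k])) => [x y _ _ xy|].
    by apply/funext => k; apply/idP/idP;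
      rewrite -/([set k | x k] k) -/([set k | y k] k) xy.
  apply: (sub_countable (subset_card_le _)
    (countable_finite_subset (finite_set_countable (finite_support s)))).
  move=> _ [_ [x _ <-] <-]; suff sx : [set k | res x k] `<=` support s.
    by split=> //; exact: sub_finite_set sx (finite_support s).
  by move=> k /andP[_ /asboolP].
have [f fP] := countable_enum (cantor_zero K : K -> bool) cres.
exists f => x _; have [n fn] : exists n, f n = res x by apply: fP; exists x.
exists n => //; exists (cantor_add (f n) x); last exact: cantor_addK.
apply: sU; apply: cylinder_eq s0 => k sk.
rewrite /cantor_add /cantor_zero fn /res.
have -> : `[< support s k >] by exact/asboolP.
by rewrite andbT addbb.
Qed.

(* For the lower bound on a basis, choose [b k] around the identity inside the
   half-space [x k = false]; each set contains a cylinder, so is [b k] for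
   finitely many [k] only. *)
Lemma cantor_weight : ~ countable [set: K] -> has_weight (Cantor K) K.
Proof.
move=> Kunc; have Kinf : infinite_set [set: K] by move=> /finite_set_countable.
have [k0 _] := infinite_setN0 Kinf.
have [i [_ iinj]] := card_le_fun_inj k0 (iffLR (infiniteP _) Kinf).
have [p pinj] := infinite_square_inj Kinf.
have [q qinj] := infinite_seq_inj Kinf.
split.
  exists (range (@cylinder K)).
    split=> [_ [s _ <-]|x U /nbhs_cylinder[s sx sU]]; first exact: open_cylinder.
    by exists (cylinder s) => //; split=> //; exists s.
  apply: card_le_trans (card_image_le _ _) _.
  apply: (@card_le_of_inj _ _ _ _ (q \o map (fun kb => p (kb.1, i (nat_of_bool kb.2))))).
    by [].
  move=> s t _ _ /qinj; apply: inj_map => -[k b] [k' b'].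
  by move=> /pinj/pair_equal_spec[/= -> /iinj bb']; congr (_, _);
    case: b b' bb' => -[] // /(_ I I).
move=> B [Bo Bb].
have /choice[b bP] k : exists V,
    [/\ B V, V (cantor_zero K) & V `<=` [set x | x k = false]].
  have [|V [BV V0] VU] := Bb (cantor_zero K) [set x | x k = false].
    have := @nbhs_agree [:: (k, false)] (cantor_zero K); apply: filterS => x; apply.
    by left.
  by exists V.
have fib V : B V -> V (cantor_zero K) -> finite_set [set k | b k = V].
  move=> BV V0; have [s s0 sV] := nbhs_cylinder (open_nbhs_nbhs (conj (Bo V BV) V0)).
  apply: sub_finite_set (finite_support s) => k bkV; apply: contrapT => nsk.
  (* The test point is the indicator of [k]: off the support it stays in the cylinder, yet its value
     at [k] is not [false]. *)
  have [_ _ /(_ (fun k' => `[< k' = k >]))] := bP k.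
  rewrite bkV /= => bk; suff : `[< k = k >] = false by move/asboolP.
  apply: bk; apply: sV; apply: cylinder_eq s0 => k' sk'.
  apply/esym/asboolP => kk'.
  by apply: nsk; rewrite -kk'.
have binf : infinite_set (range b).
  move=> finb; apply: Kunc; have -> : [set: K] = \bigcup_(V in range b) [set k | b k = V].
    by apply/seteqP; split=> // k _; exists (b k).
  apply: bigcup_countable; first exact: finite_set_countable.
  by move=> _ [k _ <-]; have [? ? _] := bP k; apply/finite_set_countable/fib.
(* Numbering each finite fibre of [b] embeds [K] in the product of [range b] and [nat], hence in the
   infinite set [range b]. *)
have /choice[rk rkP] V : exists r : K -> nat, (range b) V ->
    forall k k', b k = V -> b k' = V -> r k = r k' -> k = k'.
  have [[k _ bk]|] := pselect (range b V); last by exists (fun=> 0).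
  have [BV V0 _] := bP k; rewrite bk in BV V0.
  have /countable_injP[r rinj] := finite_set_countable (fib V BV V0).
  by exists r => _ k1 k2 bk1 bk2; apply: rinj; apply/mem_set.
have Sinf : infinite_set [set: set_type (range b)].
  move=> finS; apply: binf; apply: sub_finite_set (finite_image val finS).
  by move=> V bV; exists (SigSub (mem_set bV)).
have [v0 _] := infinite_setN0 Sinf.
have [e [_ einj]] := card_le_fun_inj v0 (iffLR (infiniteP _) Sinf).
have [r rinj] := infinite_square_inj Sinf.
pose b' k : set_type (range b) := SigSub (mem_set (imageT b k)).
apply: (@card_le_of_inj _ _ _ _ (fun k => val (r (b' k, e (rk (b k) k))))).
  by move=> k _; have [k' _ <-] := set_mem (valP (r (b' k, e (rk (b k) k))));
    have [] := bP k'.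
move=> k k' _ _ /val_inj/rinj/pair_equal_spec[/(congr1 val) /= bkk'].
move=> /einj; rewrite bkk' => /(_ I I); exact: rkP.
Qed.

End cantor_group.

Lemma BC_kappa_cantor (K : Type) : ~ countable [set: K] ->
  BC_kappa K -> BC_cantor K.
Proof.
move=> Kunc BCK X; apply: BCK.
- exact: cantor_topological_group.
- exact: cantor_aleph0_bounded.
- exact: cantor_weight.
Qed.

Unset Implicit Arguments.

Theorem theorem11 (K : Type) (hK : ~ countable [set: K]) :
  [/\ BC_kappa K -> BC_cantor K,
      BC_cantor K -> BC_cantor_subgroup K,
      BC_cantor_subgroup K -> ~ KH K
    & BorelConjecture -> ~ KH K -> BC_kappa K].
Proof.
split.
- exact: BC_kappa_cantor.
- by move=> BCK H _; exact: BCK.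
- exact: BC_cantor_subgroup_nKH.
- exact: nKH_BC_kappa.
Qed.
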